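(* Let $\mathbb{F}$ be any field and let $M$ be a matrix whose entries are linear forms over $\mathbb{F}$ in variables $x_{1,1},\ldots,x_{1,n}$ (an $\mathcal{M}_1$-matrix). Then $\operatorname{PR}(M) \le 2\operatorname{CR}(M)$.
   Context: $\mathcal{M}_1$ denotes the space of homogeneous linear forms over $\mathbb{F}$ in $x_{1,1},\ldots,x_{1,n}$ (with $n$ arbitrary). The commutative rank $\operatorname{CR}(M)$ is the rank of $M$ as a matrix over the field of rational functions $\mathbb{F}(x_{1,1},\ldots,x_{1,n})$. The partition rank $\operatorname{PR}(M)$ is the minimum $r$ such that $M$ is a sum of $r$ matrices of the form $u\otimes v$ (the matrix with $(a,b)$ entry $u_a v_b$), where one of $u,v$ is a vector with entries in $\mathbb{F}$ and the other is a vector with entries in $\mathcal{M}_1$ (which one is which may vary between summands). *)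

(* Defs.v *)
From mathcomp Require Import all_boot all_order all_algebra.
From mathcomp Require Import boolp.
From mathcomp Require Import mpoly.

Set Implicit Arguments.
Unset Strict Implicit.
Unset Printing Implicit Defensive.

Import GRing.Theory.
Local Open Scope ring_scope.

(* The zero form is included; elements coerce to {mpoly F[n]}. *)
Notation linear_form n F := (dhomog n F 1).

Section Ranks.
Variables (F : fieldType) (n p q : nat).
Implicit Types (M T : 'M[linear_form n F]_(p, q)).

Definition comm_rank M : nat :=
  \rank (\matrix_(a < p, b < q)
           tofrac (M a b : {mpoly F[n]})
         : 'M[{fraction {mpoly F[n]}}]_(p, q)).

Definition scalar_tensor_form (u : 'I_p -> F) (v : 'I_q -> linear_form n F) :
  'M[linear_form n F]_(p, q) := \matrix_(a < p, b < q) (u a *: v b).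

Definition form_tensor_scalar (u : 'I_p -> linear_form n F) (v : 'I_q -> F) :
  'M[linear_form n F]_(p, q) := \matrix_(a < p, b < q) (v b *: u a).

Definition elementary_tensor T : Prop :=
  (exists u v, T = scalar_tensor_form u v) \/
  (exists u v, T = form_tensor_scalar u v).

Definition sum_of_elementary_tensors M (r : nat) : Prop :=
  exists T : 'I_r -> 'M[linear_form n F]_(p, q),
    (forall k, elementary_tensor (T k)) /\ M = \sum_(k < r) T k.

Lemma sum_of_elementary_tensors_ex M :
  exists r, `[< sum_of_elementary_tensors M r >].
Proof.
exists p; apply/asboolP.
exists (fun k => scalar_tensor_form (fun a => (a == k)%:R) (M k)); split.
  by move=> k; left; exists (fun a => (a == k)%:R), (M k).
apply/matrixP => a b; rewrite summxE (bigD1 a) //= mxE eqxx scale1r.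
rewrite big1 ?addr0 // => k ka.
by rewrite mxE eq_sym (negPf ka) scale0r.
Qed.

Definition partition_rank M : nat := ex_minn (sum_of_elementary_tensors_ex M).

Lemma partition_rankP M r :
  partition_rank M = r <->
  sum_of_elementary_tensors M r /\
  (forall s, sum_of_elementary_tensors M s -> (r <= s)%N).
Proof.
rewrite /partition_rank; case: ex_minnP => m /asboolP Mm minm; split.
  by move=> <-; split=> // s Ms; apply/minm/asboolP.
by case=> Mr minr; apply/eqP; rewrite eqn_leq minr // minm //; apply/asboolP.
Qed.

End Ranks.

(* Main.v *)
(* The F-span L of the leading coefficient vectors (for a monomial order) of the
   polynomial vectors in the left kernel of M has dimension at least
   p - CR(M): a linear map on F^p injective on L cannot kill a nonzero
   polynomial vector of that kernel. The same holds for the span L' on the right.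
   If w M = 0 and M u = 0, then w (dM/dx_i) u = 0, as one sees by differentiating
   a full rank factorization of M; reading off the leading coefficient gives
   l (dM/dx_i) l' = 0 for all l in L and l' in L'. So M vanishes on L x L', and
   the complements of L and L' account for at most CR(M) summands each. Passing to
   leading coefficients replaces the choice of a point at which M attains its
   generic rank, which may not exist over a small finite field. *)
Require Import Defs.
From HB Require Import structures.
From mathcomp Require Import all_boot all_order all_algebra.
From mathcomp Require Import boolp.
From mathcomp Require Import mpoly.

Set Implicit Arguments.
Unset Strict Implicit.
Unset Printing Implicit Defensive.

Import Order.TTheory GRing.Theory.
Local Open Scope ring_scope.

(** * Clearing denominators over a fraction field *)

Lemma fraction_denominator (R : idomainType) (x : {fraction R}) :
  exists2 d : R, d != 0 & exists a : R, tofrac d * x = tofrac a.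
Proof.
elim/quotW: x => x; exists x.2; first exact: denom_ratioP.
exists x.1; rewrite !piE; apply/eqmodP => /=.
rewrite /FracField.equivf.
by rewrite !numden_Ratio ?mul1r ?mulr1 ?denom_ratioP ?oner_eq0 // mulrC.
Qed.

Lemma map_tofrac_eq0 (R : idomainType) p q (A : 'M[R]_(p, q)) :
  (map_mx (@tofrac R) A == 0) = (A == 0).
Proof.
apply/eqP/eqP => [/matrixP A0|->]; last exact: map_mx0.
apply/matrixP => i j; move/(_ i j): A0.
by rewrite !mxE => /eqP; rewrite tofrac_eq0 => /eqP.
Qed.

Lemma mx_common_denominator (R : idomainType) k l (W : 'M[{fraction R}]_(k, l)) :
  exists2 d : R, d != 0 & exists V : 'M[R]_(k, l),
    tofrac d *: W = map_mx (@tofrac R) V.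
Proof.
have D (ij : 'I_k * 'I_l) : exists d : R, d != 0 /\
    exists a : R, tofrac d * W ij.1 ij.2 = tofrac a.
  by have [d d0 da] := fraction_denominator (W ij.1 ij.2); exists d.
have /choice[d dP] := D; have /choice[a aP] := fun ij => (dP ij).2.
exists (\prod_ij d ij); first by apply/prodf_neq0 => ij _; exact: (dP ij).1.
exists (\matrix_(i, j) (a (i, j) * \prod_(ij | ij != (i, j)) d ij)).
apply/matrixP => i j; rewrite !mxE (bigD1 (i, j)) //= !rmorphM /= -(aP (i, j)).
by rewrite mulrAC.
Qed.

(** * Leading coefficient vectors of a left kernel *)

Lemma maximal_free_rows (F : fieldType) p (S : 'rV[F]_p -> Prop) :
  exists k (X : 'M[F]_(k, p)), [/\ row_free X, forall i, S (row i X)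
    & forall l, S l -> (l <= X)%MS].
Proof.
(* [S] is not assumed to be a subspace. A free family in [S] of maximal size still spans [S]: a
   member outside its span could be appended. *)
pose P k := `[< exists X : 'M[F]_(k, p), row_free X /\ forall i, S (row i X) >].
have P0 : exists k, P k.
  exists 0%N; apply/asboolP; exists 0; split; last by case.
  by rewrite /row_free mxrank0.
have Pp k : P k -> (k <= p)%N.
  by case/asboolP=> X [/eqP Xr _]; rewrite -Xr rank_leq_col.
case: (ex_maxnP P0 Pp) => k /asboolP[X [Xfree XS]] kmax.
exists k, X; split=> // l Sl; apply/negPn/negP => lX.
suff /kmax : P (k + 1)%N by rewrite addn1 ltnn.
apply/asboolP; exists (col_mx X l); split=> [|i].
  apply: inj_row_free => v; rewrite -[v]hsubmxK mul_row_col.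
  have [c0|c0] := eqVneq (rsubmx v) 0.
    rewrite c0 mul0mx addr0 => /eqP; rewrite mulmx_free_eq0 // => /eqP->.
    by rewrite row_mx0.
  move=> /eqP; rewrite addrC addr_eq0 => /eqP vX; case/negP: lX.
  have c00 : rsubmx v 0 0 != 0.
    by apply: contraNneq c0 => c00; apply/eqP/rowP => i; rewrite ord1 c00 mxE.
  rewrite -(eqmx_scale l c00).
  by rewrite -mul_scalar_mx -mx11_scalar vX eqmx_opp submxMl.
by case: (split_ordP i) => j ->; rewrite ?rowKu ?rowKd // row_id.
Qed.

(** One monomial [m] serves all coordinates, so those with a smaller leading monomial contribute 0.
    As [m] is only an upper bound, [l] may vanish. *)
Definition initial_in_lker (F : fieldType) n p q (A : 'M[{mpoly F[n]}]_(p, q))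
    (l : 'rV[F]_p) :=
  exists (w : 'rV[{mpoly F[n]}]_p) (m : 'X_{1..n}),
    [/\ w *m A = 0, forall j, (mlead (w 0 j) <= m)%O
      & l = map_mx (mcoeff m) w].

Lemma initial_neq0 (F : fieldType) n p (w : 'rV[{mpoly F[n]}]_p) : w != 0 ->
  exists m : 'X_{1..n},
    (forall j, (mlead (w 0 j) <= m)%O) /\ map_mx (mcoeff m) w != 0.
Proof.
case/rV0Pn => j0 wj0.
(* Only nonzero entries compete: since [mlead 0 = 0], a zero entry could otherwise attain the
   maximum when all entries are constant. *)
case: (@arg_maxP _ _ _ j0 (fun j => w 0 j != 0) (fun j => mlead (w 0 j)) wj0).
move=> j wj jmax; exists (mlead (w 0 j)); split=> [i|].
  have [->|/jmax//] := eqVneq (w 0 i) 0.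
  by rewrite mlead0; exact: le0x.
by apply/rV0Pn; exists j; rewrite mxE mleadc_eq0.
Qed.

Lemma polynomial_lker (R : idomainType) p q (A : 'M[R]_(p, q)) :
  (\rank (map_mx (@tofrac R) A) < p)%N ->
  exists2 w : 'rV[R]_p, w != 0 & w *m A = 0.
Proof.
move=> rA; have : kermx (map_mx (@tofrac R) A) != 0.
  by rewrite kermx_eq0 /row_free neq_ltn rA.
case/rowV0Pn => v /sub_kermxP vA v0.
have [d d0 [w dv]] := mx_common_denominator v.
exists w.
  apply: contraNneq v0 => w0; move: dv; rewrite w0 map_mx0 => /eqP.
  by rewrite scaler_eq0 tofrac_eq0 (negPf d0).
by apply/eqP; rewrite -map_tofrac_eq0 map_mxM -dv -scalemxAl vA scaler0.
Qed.

Lemma initial_lker_rank (F : fieldType) n p q (A : 'M[{mpoly F[n]}]_(p, q)) :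
  exists k (X : 'M[F]_(k, p)), [/\ row_free X,
    (p <= k + \rank (map_mx (@tofrac _) A))%N
    & forall i, initial_in_lker A (row i X)].
Proof.
have [k [X [Xfree XA Xmax]]] := maximal_free_rows (initial_in_lker A).
exists k, X; split=> //; rewrite leqNgt; apply/negP => kp.
(* [phi] takes coordinates with respect to [X], so it is injective on the span of [X]. Appending its
   [k] columns to [A] keeps the rank below [p], which yields a nonzero [w] killed by both. As [phi]
   is constant, it also kills the leading coefficient vector of [w], which is nonzero and lies in
   that span. *)
pose phi : 'M[{mpoly F[n]}]_(p, k) := map_mx (@mpolyC n F) (pinvmx X).
have /polynomial_lker [w w0] : (\rank (map_mx (@tofrac _) (row_mx A phi)) < p)%N.
  apply: leq_ltn_trans kp; rewrite map_row_mx -mxrank_tr tr_row_mx -addsmxE.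
  apply: leq_trans (mxrank_adds_leqif _ _) _.
  by rewrite !mxrank_tr addnC leq_add2r rank_leq_col.
rewrite mul_mx_row => /eqP; rewrite row_mx_eq0 => /andP[/eqP wA /eqP wphi].
have [m [wm]] := initial_neq0 w0; set l := map_mx _ w => l0.
have /Xmax lX : initial_in_lker A l by exists w, m.
case/eqP: l0; rewrite -(mulmxKpV lX).
suff -> : l *m pinvmx X = 0 by rewrite mul0mx.
apply/rowP => j; move/rowP: wphi => /(_ j) /(congr1 (mcoeff m)).
rewrite !mxE raddf0 raddf_sum /= => wj; apply: etrans wj; apply: eq_bigr => i _.
by rewrite !mxE [in RHS]mulrC mul_mpolyC mcoeffZ mulrC.
Qed.

(** * Differentiation between the two kernels *)

Lemma mderiv_mulmx (F : fieldType) n p q r (i : 'I_n)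
    (A : 'M[{mpoly F[n]}]_(p, r)) (B : 'M[{mpoly F[n]}]_(r, q)) :
  map_mx (mderiv i) (A *m B) =
    map_mx (mderiv i) A *m B + A *m map_mx (mderiv i) B.
Proof.
apply/matrixP => a b; rewrite !mxE raddf_sum -big_split /=.
by apply: eq_bigr => k _; rewrite !mxE mderivM.
Qed.

Lemma mderiv_lker_rker (F : fieldType) n p q (i : 'I_n)
    (A : 'M[{mpoly F[n]}]_(p, q)) (w : 'rV_p) (u : 'cV_q) :
  w *m A = 0 -> A *m u = 0 -> w *m map_mx (mderiv i) A *m u = 0.
Proof.
move=> wA Au; pose AK := map_mx (@tofrac _) A.
have [c c0 [C cC]] := mx_common_denominator (col_base AK).
have [d d0 [D dD]] := mx_common_denominator (row_base AK).
(* A full rank factorization of [A], cleared of denominators. Full rank lets [w] kill the left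
   factor and [u] the right one. *)
have CD : (c * d) *: A = C *m D.
  apply/eqP; rewrite -subr_eq0 -map_tofrac_eq0 map_mxB map_mxM map_mxZ rmorphM.
  by rewrite /= -cC -dD -scalemxAl -scalemxAr mulmx_base scalerA subrr.
have wC : w *m C = 0.
  apply/eqP; rewrite -map_tofrac_eq0 map_mxM -cC -scalemxAr scaler_eq0.
  rewrite tofrac_eq0 (negPf c0) -(mulmx_free_eq0 _ (row_base_free AK)) -mulmxA.
  by rewrite mulmx_base -map_mxM wA map_mx0 eqxx.
have Du : D *m u = 0.
  apply/eqP; rewrite -map_tofrac_eq0 map_mxM -dD -scalemxAl scaler_eq0.
  rewrite tofrac_eq0 (negPf d0) /= -(inj_eq (row_full_inj (col_base_full AK))).
  by rewrite mulmxA mulmx_base -map_mxM Au map_mx0 mulmx0 eqxx.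
(* In the product rule, the derivative of [c * d] comes with [A *m u = 0], that of [C] with
   [D *m u = 0], and that of [D] with [w *m C = 0]. *)
have : (c * d) *: (w *m map_mx (mderiv i) A *m u) = 0.
  have : map_mx (mderiv i) ((c * d) *: A) = map_mx (mderiv i) (C *m D).
    by rewrite CD.
  rewrite -mul_scalar_mx !mderiv_mulmx => /(congr1 (fun B => w *m B *m u)).
  rewrite !(mulmxDr, mulmxDl) -!mulmxA Du Au !mulmx0 !add0r !mulmxA wC !mul0mx.
  by rewrite mul_mx_scalar -!scalemxAl.
move=> /eqP; rewrite -map_tofrac_eq0 map_mxZ scaler_eq0 tofrac_eq0 mulf_eq0.
by rewrite (negPf c0) (negPf d0) map_tofrac_eq0 => /eqP.
Qed.

Lemma row_free_complement (F : fieldType) k p (X : 'M[F]_(k, p)) :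
  row_free X -> exists (B : 'M_(p, k)) (C : 'M_(p, p - k)) (D : 'M_(p - k, p)),
    1%:M = B *m X + C *m D.
Proof.
move=> /eqP Xr.
have /sub_addsmxP[[B C] /= BC] : (1%:M <= X + X^C)%MS.
  exact/submx_full/addsmx_compl_full.
have Cr : \rank X^C = (p - k)%N by rewrite mxrank_compl Xr.
exists B; rewrite -Cr; exists (C *m col_base X^C%MS), (row_base X^C%MS).
by rewrite -mulmxA mulmx_base.
Qed.

(** * Linear forms through their coefficients *)

Definition linear_coef (F : fieldType) n (i : 'I_n) (f : linear_form n F) : F :=
  (f : {mpoly F[n]})@_(U_(i)).

Lemma linear_coef_is_zmod_morphism (F : fieldType) n (i : 'I_n) :
  zmod_morphism (@linear_coef F n i).
Proof. by move=> f g; rewrite /linear_coef raddfB. Qed.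

HB.instance Definition _ (F : fieldType) n (i : 'I_n) :=
  GRing.isZmodMorphism.Build (linear_form n F) F (@linear_coef F n i)
    (@linear_coef_is_zmod_morphism F n i).

Lemma linear_coefZ (F : fieldType) n (i : 'I_n) c (f : linear_form n F) :
  linear_coef i (c *: f) = c * linear_coef i f.
Proof. by rewrite /linear_coef /= mcoeffZ. Qed.

Lemma linear_form_eq (F : fieldType) n (f g : linear_form n F) :
  (forall i, linear_coef i f = linear_coef i g) -> f = g.
Proof.
move=> fg; apply: val_inj; apply/mpolyP => m /=.
have [/mdeg1P[i /eqP->]|m1] := boolP (mdeg m == 1%N); first exact: fg.
have fm (h : linear_form n F) : (h : {mpoly F[n]})@_m = 0.
  by apply: (@dhomog_nemf_coeff _ _ mdeg 1) => //; case: h.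
by rewrite !fm.
Qed.

Lemma mderiv_linear_form (F : fieldType) n (f : linear_form n F) i :
  mderiv i f = (linear_coef i f)%:MP.
Proof.
apply/mpolyP => m; rewrite /linear_coef mcoeff_mderiv mcoeffC.
have [->|m0] := eqVneq m 0%MM.
  by rewrite add0m mnm0E mulr1 mulr1n.
rewrite mulr0 (@dhomog_nemf_coeff _ _ mdeg 1) ?mul0rn //; first by case: f.
by rewrite /= mdegD mdeg1 addn1 eqSS mdeg_eq0.
Qed.

Lemma initial_lker_rker_coef (F : fieldType) n p q k k'
    (M : 'M[linear_form n F]_(p, q)) (X : 'M_(k, p)) (Y : 'M_(k', q)) i
    (A := map_mx (@mpoly_of_dhomog n F 1) M) :
    (forall a, initial_in_lker A (row a X)) ->
    (forall b, initial_in_lker A^T (row b Y)) ->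
  X *m map_mx (linear_coef i) M *m Y^T = 0.
Proof.
move=> XA YA; apply/matrixP => a b.
have [w [m [wA wm aX]]] := XA a; have [u [m' [uA um bY]]] := YA b.
have Au : A *m u^T = 0 by apply: trmx_inj; rewrite trmx_mul trmxK uA trmx0.
have /matrixP/(_ 0 0) := mderiv_lker_rker i wA Au.
(* The derivative of [A] is constant, and [m], [m'] bound the leading monomials of [w] and [u];
   hence the coefficient at [m + m'] of each product is the product of the coefficients at [m] and
   [m']. *)
move/(congr1 (mcoeff (m + m')%MM)); rewrite !mxE raddf0 raddf_sum /=.
move=> wAu; apply: etrans wAu; apply: eq_bigr => d _.
rewrite !mxE !mulr_suml raddf_sum /=; apply: eq_bigr => c _.
rewrite !mxE mderiv_linear_form [in RHS]mulrAC [in RHS]mulrC.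
rewrite mul_mpolyC mcoeffZ mleadcMW // mulrAC mulrC; congr (_ * (_ * _)).
  by move/rowP/(_ c): aX; rewrite !mxE.
by move/rowP/(_ d): bY; rewrite !mxE.
Qed.

(** The scalar matrices are the same for every variable [i], so the identity lifts to [M]: columns
    of [C] pair with rows of linear forms from [D M], and columns of linear forms from [E M D'] pair
    with rows of [C']. *)
Lemma sum_of_elementary_tensors_coef (F : fieldType) n p q r r'
    (M : 'M[linear_form n F]_(p, q)) (C : 'M_(p, r)) (D : 'M_(r, p))
    (E : 'M_(p, p)) (D' : 'M_(q, r')) (C' : 'M_(r', q)) :
    (forall i (N := map_mx (linear_coef i) M),
      N = C *m (D *m N) + E *m (N *m D') *m C') ->
  sum_of_elementary_tensors M (r + r').
Proof.
move=> NE; pose S (j : 'I_r) := scalar_tensor_form (fun a => C a j)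
  (fun b => \sum_c D j c *: M c b).
pose T (j : 'I_r') := form_tensor_scalar
  (fun a => \sum_c E a c *: \sum_d D' d j *: M c d) (fun b => C' j b).
exists (fun j => match split j with inl j => S j | inr j => T j end); split=> [j|].
  case: (split j) => {}j; first by left; exists (fun a => C a j); eexists.
  by right; eexists; exists (fun b => C' j b).
rewrite big_split_ord /=.
under eq_bigr => j _ do rewrite (unsplitK (inl _ j)).
under [X in _ + X]eq_bigr => j _ do rewrite (unsplitK (inr _ j)).
apply/matrixP => a b; apply: linear_form_eq => i.
move/matrixP/(_ a b): (NE i); rewrite !mxE => ->.
rewrite !summxE raddfD !raddf_sum /=; congr (_ + _); apply: eq_bigr => j _.
  rewrite !mxE linear_coefZ raddf_sum /=; congr (_ * _).
  by apply: eq_bigr => c _; rewrite linear_coefZ !mxE.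
rewrite !mxE linear_coefZ mulrC raddf_sum /=; congr (_ * _).
apply: eq_bigr => c _; rewrite linear_coefZ raddf_sum [X in _ * X]mxE.
congr (_ * _).
by apply: eq_bigr => d _; rewrite /= linear_coefZ !mxE mulrC.
Qed.

Theorem corollary1p3 (F : fieldType) (n p q : nat)
    (M : 'M[linear_form n F]_(p, q)) :
  (partition_rank M <= 2 * comm_rank M)%N.
Proof.
have [_ prank_min] := (partition_rankP M _).1 erefl.
pose A := map_mx (@mpoly_of_dhomog n F 1) M.
have rA : comm_rank M = \rank (map_mx (@tofrac _) A).
  by congr (\rank _); apply/matrixP => a b; rewrite !mxE.
have [k [X [Xfree kX XA]]] := initial_lker_rank A.
have [k' [Y [Yfree kY YA]]] := initial_lker_rank A^T.
rewrite -map_trmx mxrank_tr -rA in kY; rewrite -rA in kX.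
have [B [C [D XD]]] := row_free_complement Xfree.
have [B' [C' [D' YD]]] := row_free_complement Yfree.
suff /prank_min/leq_trans : sum_of_elementary_tensors M ((p - k) + (q - k')).
  by apply; rewrite mul2n -addnn leq_add // leq_subLR.
apply: (@sum_of_elementary_tensors_coef _ _ _ _ _ _ _ C D (B *m X) D'^T C'^T).
(* Splitting the identity on the left gives [N = C D N + B X N]. Splitting it on the right of
   [B X N] leaves only the [D'^T C'^T] term, because [X N Y^T = 0]. *)
move=> i N; rewrite -[LHS]mul1mx XD mulmxDl addrC mulmxA; congr (_ + _).
rewrite -[LHS]mulmx1 -trmx1 YD linearD /= !trmx_mul mulmxDr.
have XNY : X *m N *m Y^T = 0 := initial_lker_rker_coef i XA YA.
by rewrite !mulmxA -!(mulmxA B) XNY mul0mx mulmx0 add0r !mulmxA.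
Qed.
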